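(* Let $R=[a,b]\times[c,d]$, $\beta\in[2,3]$, and let $\{g_1,\dots,g_n\}$ be a linearly independent subset of $\mathcal{C}_\beta(R)$. Let $f:R\to\mathbb{R}$ be a bounded below and Lebesgue integrable function. Then there exists a best one-sided approximation from below to $f$ on $R$ in $\mathcal{Y}_n^\beta(f)$, i.e. there is $h_f\in\mathcal{Y}_n^\beta(f)$ with $$\int_R h_f(\boldsymbol{x})\,d\boldsymbol{x}=\sup\Big\{\int_R h(\boldsymbol{x})\,d\boldsymbol{x}: h\in\mathcal{Y}_n^\beta(f)\Big\}.$$
   Context: $a<b$ and $c<d$ are real numbers. $\mathcal{C}_\beta(R):=\{f\in\mathcal{C}(R):\overline{\dim}_B(Gr(f))\le\beta\}$, where $\mathcal{C}(R)$ is the space of continuous real-valued functions on $R$, $Gr(f)\subset\mathbb{R}^3$ is the graph of $f$ and $\overline{\dim}_B$ is the upper box dimension; $\mathcal{C}_\beta(R)$ is a normed linear space. For the given $g_1,\dots,g_n$ and $f$, $$\mathcal{Y}_n^\beta(f):=\{h\in\mathrm{span}\{g_1,\dots,g_n\}: h(\boldsymbol{x})\le f(\boldsymbol{x})\ \text{for all }\boldsymbol{x}\in R\}.$$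
   Formalization: The formal theorem also assumes that Y_n^β(f) is nonempty; without this the claim fails, e.g. for n = 1, g_1(x,y) = x − a and f = −1, where no multiple of g_1 lies below f. *)

(* Defs.v *)
From HB Require Import structures.
From mathcomp Require Import all_boot all_order all_algebra.
From mathcomp Require Import all_classical all_reals all_analysis.

Set Implicit Arguments.
Unset Strict Implicit.
Unset Printing Implicit Defensive.

Import Order.TTheory GRing.Theory Num.Theory.
Import numFieldNormedType.Exports.

Local Open Scope classical_set_scope.
Local Open Scope ring_scope.

(* Functions on a set D of the plane are represented by total functions
   R * R -> R of which only the values on D matter: every notion below is
   relative to D. *)

Definition rectangle (R : realType) (a b c d : R) : set (R * R) :=
  `[a, b]%classic `*` `[c, d]%classic.

(* The Lebesgue (not just Borel) measure of the plane: the extension of the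
   product of the Borel measures to the Caratheodory-measurable sets, as for
   [completed_lebesgue_measure] on the line. *)
Definition lebesgue2 (R : realType) : set _ -> \bar R :=
  @completed_measure_extension _ _ _
    (@lebesgue_measure R \x @lebesgue_measure R)%E.
HB.instance Definition _ (R : realType) := Measure.on (@lebesgue2 R).

(* The product topology of R * R * R is that of the max norm, hence an explicit
   Euclidean distance. *)
Definition edist3 (R : realType) (p q : R * R * R) : R :=
  Num.sqrt ((p.1.1 - q.1.1) ^+ 2 + (p.1.2 - q.1.2) ^+ 2 + (p.2 - q.2) ^+ 2).

Definition diam_le (R : realType) (U : set (R * R * R)) (delta : R) : Prop :=
  forall p q, U p -> U q -> edist3 p q <= delta.

Definition coverable (R : realType) (F : set (R * R * R)) (delta : R)
    (k : nat) : Prop :=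
  exists U : 'I_k -> set (R * R * R),
    (forall i, diam_le (U i) delta) /\ F `<=` \bigcup_i U i.

(* Least number of sets of diameter at most delta covering F; +oo if F has no
   finite such cover. *)
Definition covering_number (R : realType) (F : set (R * R * R)) (delta : R) :
    \bar R :=
  ereal_inf [set (k%:R)%:E | k in coverable F delta].

Definition upper_box_dim (R : realType) (F : set (R * R * R)) : \bar R :=
  limf_esup
    (fun delta : R => (lne (covering_number F delta) * ((- ln delta)^-1)%:E)%E)
    0^'+.

Definition graph_on (R : realType) (D : set (R * R)) (f : R * R -> R) :
    set (R * R * R) :=
  [set p | D p.1 /\ p.2 = f p.1].

Definition C_beta (R : realType) (D : set (R * R)) (beta : R) :
    set (R * R -> R) :=
  [set f | {within D, continuous f} /\
           (upper_box_dim (graph_on D f) <= beta%:E)%E].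

Definition lin_indep_on (R : realType) (D : set (R * R)) (n : nat)
    (g : 'I_n -> R * R -> R) : Prop :=
  forall l : 'I_n -> R,
    (forall x, D x -> \sum_(i < n) l i * g i x = 0) -> forall i, l i = 0.

Definition span_on (R : realType) (D : set (R * R)) (n : nat)
    (g : 'I_n -> R * R -> R) : set (R * R -> R) :=
  [set h | exists l : 'I_n -> R,
    forall x, D x -> h x = \sum_(i < n) l i * g i x].

Definition Y_below (R : realType) (D : set (R * R)) (n : nat)
    (g : 'I_n -> R * R -> R) (f : R * R -> R) : set (R * R -> R) :=
  [set h | span_on D g h /\ forall x, D x -> h x <= f x].

Definition best_approx_below (R : realType) (D : set (R * R)) (n : nat)
    (g : 'I_n -> R * R -> R) (f h : R * R -> R) : Prop :=
  Y_below D g f h /\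
  (\int[@lebesgue2 R]_(x in D) (h x)%:E =
   ereal_sup [set \int[@lebesgue2 R]_(x in D) (k x)%:E | k in Y_below D g f])%E.

(* Main.v *)
(* Some h0 lies in the feasible set, and only feasible h with int h >= int h0
   compete for the supremum.  For these, |h| <= (f - h) + |f| bounds the L1 norm
   of h by int f - int h0 + int |f|.  Since the g_i are continuous and linearly
   independent, the L1 norm of a combination dominates the norm of its
   coefficient vector, so the competing coefficient vectors form a compact set,
   on which the continuous functional int h attains its maximum. *)
Require Import Defs.
From mathcomp Require Import all_boot all_order all_algebra.
From mathcomp Require Import lra.
From mathcomp Require Import all_classical all_reals all_analysis.

Import Order.TTheory GRing.Theory Num.Theory.
Import numFieldNormedType.Exports.

Local Open Scope classical_set_scope.
Local Open Scope ring_scope.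

(** * Linear combinations as functions of their coefficients *)

Section linear_combinations.
Context {R : realType} {T : Type} {n : nat}.
Implicit Types (g : 'I_n -> T -> R) (l : 'rV[R]_n) (x : T).

(** The coefficients form a row vector, so that they live in a normed space whose closed bounded
    sets are compact. *)
Definition lincomb g l x : R := \sum_(i < n) l ord0 i * g i x.

Lemma lincombB g l l' x : lincomb g (l - l') x = lincomb g l x - lincomb g l' x.
Proof. by rewrite -sumrB; apply: eq_bigr => i _; rewrite !mxE mulrBl. Qed.

Lemma lincombZ g k l x : lincomb g (k *: l) x = k * lincomb g l x.
Proof. by rewrite mulr_sumr; apply: eq_bigr => i _; rewrite !mxE mulrA. Qed.

Lemma continuous_lincomb g x : continuous (fun l => lincomb g l x).
Proof.
apply: continuous_big => [|i _ l]; first exact: add_continuous.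
by apply: continuousM; [exact: (@coord_continuous R)|exact: cst_continuous].
Qed.

Lemma coord_le_norm l (i : 'I_n) : `|l ord0 i| <= `|l|.
Proof.
rewrite [leRHS]/Num.norm /= mx_normrE.
exact: (le_bigmax _ (fun ij => `|l ij.1 ij.2|) (ord0, i)).
Qed.

Lemma lincomb_le_norm g l x : `|lincomb g l x| <= `|l| * \sum_(i < n) `|g i x|.
Proof.
rewrite mulr_sumr; apply: (le_trans (ler_norm_sum _ _ _)).
by apply: ler_sum => i _; rewrite normrM ler_wpM2r// coord_le_norm.
Qed.

End linear_combinations.

Lemma within_continuous_lincomb {R : realType} {T : topologicalType} {n : nat}
    {D : set T} {g : 'I_n -> T -> R} (l : 'rV[R]_n) :
  (forall i, {within D, continuous (g i)}) ->
  {within D, continuous (lincomb g l)}.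
Proof.
move=> cg; apply: continuous_big => [|i _ x]; first exact: add_continuous.
by apply: continuousM; [exact: cst_continuous|exact: cg].
Qed.

(** * The L1 norm and the integral on the span, for an arbitrary measure *)

Section integrable_span.
Set Implicit Arguments.
Unset Strict Implicit.
Context d (T : measurableType d) (R : realType) (mu : {measure set T -> \bar R}).
Variables (D : set T) (n : nat) (g : 'I_n -> T -> R).
Hypotheses (mD : measurable D)
  (ig : forall i, mu.-integrable D (EFin \o g i)).

Let integrable_sumR (F : 'I_n -> T -> R) :
  (forall i, mu.-integrable D (EFin \o F i)) ->
  mu.-integrable D (EFin \o (fun x => \sum_(i < n) F i x)).
Proof.
move=> iF; apply: (eq_integrable mD (fun x => \sum_(i < n) (F i x)%:E)%E).
  by move=> x _; rewrite /= sumEFin.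
by apply: integrable_sum => // i _; exact: iF.
Qed.

Lemma integrable_lincomb l : mu.-integrable D (EFin \o lincomb g l).
Proof.
apply: integrable_sumR => i; exact: (integrableZl mD _ (ig i)).
Qed.

(* The integrals of the g_i are seen as constant functions, so that
   [continuous_lincomb] applies. *)
Lemma Rintegral_lincomb l :
  \int[mu]_(x in D) lincomb g l x =
  lincomb (fun i (_ : T) => \int[mu]_(x in D) g i x) l point.
Proof.
apply: EFin_inj; rewrite /Rintegral fineK; last first.
  exact: integrable_fin_num (integrable_lincomb l).
rewrite /lincomb -sumEFin.
under eq_integral do rewrite -sumEFin.
rewrite integral_sum //; last first.
  by move=> i; exact: (integrableZl mD _ (ig i)).
apply: eq_bigr => i _.
rewrite EFinM fineK; last exact: integrable_fin_num (ig i).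
by rewrite -(integralZl mD (ig i)).
Qed.

Let N l := \int[mu]_(x in D) `|lincomb g l x|.

Let iN l : mu.-integrable D (EFin \o (fun x => `|lincomb g l x|)).
Proof. by apply: integrable_norm; exact: integrable_lincomb. Qed.

(** Integrating the reverse triangle inequality together with [lincomb_le_norm] shows that [N] is
    Lipschitz, the constant being the integral of the sum of the |g_i|. *)
Let continuous_N : continuous N.
Proof.
pose G x := \sum_(i < n) `|g i x|.
have iG : mu.-integrable D (EFin \o G).
  by apply: integrable_sumR => i; apply: integrable_norm; exact: ig.
pose k := \int[mu]_(x in D) G x.
have N_lip l l' : N l - N l' <= `|l - l'| * k.
  rewrite -RintegralB// -RintegralZl//; apply: le_Rintegral => //.
  - exact: (integrableB mD (iN l) (iN l')).
  - exact: (integrableZl mD _ iG).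
  - move=> x _; rewrite (le_trans _ (lincomb_le_norm _ _ _))// lincombB.
    exact: lerB_dist.
have {}N_lip l l' : `|N l - N l'| <= `|l - l'| * k.
  by rewrite ler_norml N_lip lerNl opprB distrC N_lip.
have k0 : 0 <= k by apply: Rintegral_ge0 => x _; exact: sumr_ge0.
move=> l; apply/(@cvgrPdist_le _ _ _ (nbhs l) (nbhs_filter l)) => e e0.
(* Since [k] may vanish, the radius is divided by [k + 1]. *)
have ek0 : 0 < e / (k + 1) by rewrite divr_gt0// ltr_wpDl.
apply: filterS (nbhsx_ballx l _ ek0) => l'.
rewrite -ball_normE /= => /ltW ll'; rewrite (le_trans (N_lip _ _))//.
rewrite (@le_trans _ _ (`|l - l'| * (k + 1)))// ?ler_wpM2l ?lerDl//.
by rewrite -ler_pdivlMr// ltr_wpDl.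
Qed.

(* On the unit sphere of the coefficients the L1 norm has a positive minimum. *)
Lemma lincomb_L1_lower_bound :
  (forall l, l != 0 -> 0 < \int[mu]_(x in D) `|lincomb g l x|) ->
  exists2 c, 0 < c & forall l, c * `|l| <= \int[mu]_(x in D) `|lincomb g l x|.
Proof.
move=> Npos; pose S := [set l : 'rV[R]_n | `|l| = 1].
have scale l : l != 0 -> S (`|l|^-1 *: l).
  by move=> l0; rewrite /S /= normrZ normfV normr_id mulVf// normr_eq0.
have NZ l : l != 0 -> N l = `|l| * N (`|l|^-1 *: l).
  move=> l0; rewrite -RintegralZl//; apply: eq_Rintegral => x _.
  by rewrite lincombZ normrM normfV normr_id mulrA mulfV ?mul1r// normr_eq0.
have N0 l : 0 <= N l by apply: Rintegral_ge0 => x _; exact: normr_ge0.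
have [Se|/set0P Sne] := eqVneq S set0.
  (* An empty sphere, the case n = 0, leaves only the zero vector, for which any constant works. *)
  exists 1 => // l; have [->|/scale] := eqVneq l 0; last by rewrite Se.
  by rewrite normr0 mulr0; exact: N0.
have cS : compact S.
  apply: bounded_closed_compact.
    by exists 1; split => // y y1 l /= ->; exact: ltW.
  apply: (@closed_comp _ _ (fun l : 'rV[R]_n => `|l|) [set 1]).
    by move=> l _; exact: norm_continuous.
  exact: closed_eq.
have [l1 /set_mem l1S l1min] :=
  compact_EVT_min Sne cS (continuous_subspaceT continuous_N).
exists (N l1).
  by apply: Npos; apply: contra_eq_neq l1S => ->; rewrite normr0 eq_sym oner_neq0.
move=> l; have [->|l0] := eqVneq l 0; first by rewrite normr0 mulr0; exact: N0.
rewrite -/(N l) [leRHS]NZ// mulrC ler_wpM2l//.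
by apply: l1min; rewrite inE; exact: scale.
Qed.

(** Positivity of the L1 norm off zero stands in for continuity and linear independence, so the
    argument uses no topology on [T]. *)
Lemma best_lincomb_below (f : T -> R) (l0 : 'rV[R]_n) :
  mu.-integrable D (EFin \o f) ->
  (forall l, l != 0 -> 0 < \int[mu]_(x in D) `|lincomb g l x|) ->
  (forall x, D x -> lincomb g l0 x <= f x) ->
  exists2 l1, forall x, D x -> lincomb g l1 x <= f x &
    forall l, (forall x, D x -> lincomb g l x <= f x) ->
      \int[mu]_(x in D) lincomb g l x <= \int[mu]_(x in D) lincomb g l1 x.
Proof.
move=> fi Npos l0f; have [c c0 cN] := lincomb_L1_lower_bound Npos.
pose I (l : 'rV[R]_n) : R := \int[mu]_(x in D) lincomb g l x.
have cI : continuous I.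
  by rewrite (funext Rintegral_lincomb : I = _); exact: continuous_lincomb.
(* The feasible vectors alone may form an unbounded set; the lower bound on the integral is what
   makes [K] bounded. *)
pose K := [set l | forall x, D x -> lincomb g l x <= f x] `&` [set l | I l0 <= I l].
have K0 : K l0 by split => /=.
have cK : compact K.
  apply: bounded_closed_compact; last first.
    (* Feasibility is an intersection, over the points of [D], of preimages of closed half-lines
       under evaluation; the other condition is such a preimage under [I]. *)
    apply: closedI.
      rewrite (_ : mkset _ = \bigcap_(x in D)
          ((lincomb g)^~ x @^-1` [set y | y <= f x])); last by apply/seteqP; split.
      apply: closed_bigI => x _; apply: closed_comp; last exact: closed_le.
      move=> l _; exact: continuous_lincomb.
    apply: (@closed_comp _ _ I [set y | I l0 <= y]); last exact: closed_ge.
    by move=> l _; exact: cI.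
  (* [M] bounds the L1 norm of [lincomb g l] for [l] in [K], and dividing by [c] bounds |l|. *)
  pose M := \int[mu]_(x in D) f x - I l0 + \int[mu]_(x in D) `|f x|.
  exists (c^-1 * M); split; first exact: num_real.
  move=> y My l [/= lf Il].
  rewrite (le_trans _ (ltW My))// ler_pdivlMl// (le_trans (cN l))//.
  have il := integrable_lincomb l.
  have ifl : mu.-integrable D (EFin \o (f \- lincomb g l)).
    exact: (integrableB mD fi il).
  have ifn : mu.-integrable D (EFin \o (fun x => `|f x|)) by exact: integrable_norm.
  rewrite (@le_trans _ _ (\int[mu]_(x in D) ((f x - lincomb g l x) + `|f x|)))//.
    apply: le_Rintegral => //; first exact: (integrableD mD ifl ifn).
    (* Write h = f - (f - h), where f - h >= 0 by feasibility. *)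
    move=> x Dx; rewrite -[X in `|X|](subKr (f x)) (le_trans (ler_normB _ _))//.
    by rewrite addrC lerD2r ger0_norm// subr_ge0 lf.
  by rewrite RintegralD// RintegralB// lerD2r lerD2l lerN2.
have [l1 /set_mem[l1f Il1] l1max] :=
  compact_EVT_max (ex_intro _ l0 K0) cK (continuous_subspaceT cI).
(* A feasible [l] outside [K] has integral below [I l0], which [l1] already reaches. *)
exists l1 => // l lf; have [Il|/ltW Il] := leP (I l0) (I l).
  by apply: l1max; rewrite inE.
exact: le_trans Il Il1.
Qed.

End integrable_span.

(** * Continuous functions and the Lebesgue measure on rectangles *)

Section lebesgue2_theory.
Set Implicit Arguments.
Unset Strict Implicit.
Context {R : realType}.
(** One set under two sigma-algebras: [plane] has the product of the Borel ones, [lplane] the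
    Caratheodory-measurable sets of [lebesgue2]. *)
Local Notation plane := (measurableTypeR R * measurableTypeR R)%type.
Local Notation lplane := (caratheodory_type
  ((@lebesgue_measure R \x @lebesgue_measure R)%E^*)%mu).

(** An open set is the countable union of the open boxes with rational ends that it contains. *)
Lemma open_measurable_plane (U : set (R * R)) :
  open U -> measurable (U : set plane).
Proof.
move=> oU.
pose box (q : rat * rat * (rat * rat)) : set plane :=
  `]ratr q.1.1, ratr q.1.2[%classic `*` `]ratr q.2.1, ratr q.2.2[%classic.
(* Boxes that leave [U] become empty, so the union can run over a whole countable type. *)
pose F q := if `[< box q `<=` U >] then box q else set0.
have -> : U = \bigcup_q F q.
  apply/seteqP; split=> [p Up|p [q _]]; last first.
    by rewrite /F; case: asboolP => // + qp; exact.
  have /nbhs_ballP[e /= e0 eU] : nbhs p U by exact: open_nbhs_nbhs.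
  have near_rat (x : R) : exists q : rat * rat,
      (x \in `]ratr q.1, ratr q.2[) /\
      (forall y, y \in `]ratr q.1, ratr q.2[ -> ball x e y).
    have /rat_in_itvoo[q] : x - e < x by rewrite ltrBlDr ltrDl.
    rewrite in_itv /= => /andP[q1 q2].
    have /rat_in_itvoo[r] : x < x + e by rewrite ltrDl.
    rewrite in_itv /= => /andP[r1 r2].
    exists (q, r); rewrite /= in_itv /= q2 r1; split => // y /=.
    rewrite in_itv /= => /andP[qy yr].
    by rewrite -ball_normE /= ltr_distlC (lt_trans q1 qy) (lt_trans yr r2).
  have [q [qp qe]] := near_rat p.1.
  have [r [rp re]] := near_rat p.2.
  exists (q, r) => //; rewrite /F; case: asboolP => // -[].
  by move=> y [/= /qe y1 /re y2]; exact/eU.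
apply: countable_bigcupT_measurable => // q; rewrite /F.
by case: asboolP => // _; apply: measurableX; exact: measurable_itv.
Qed.

Lemma lebesgue2_measurable (A : set (R * R)) :
  measurable (A : set plane) -> measurable (A : set lplane).
Proof. exact: caratheodory_measurable_mu_ext. Qed.

Lemma measurable_rectangle (a b c d : R) :
  measurable (rectangle a b c d : set plane).
Proof. by apply: measurableX; exact: measurable_itv. Qed.

Lemma lebesgue2_rectangle (a b c d : R) : a <= b -> c <= d ->
  lebesgue2 (rectangle a b c d) = ((b - a) * (d - c))%:E.
Proof.
move=> ab cd; rewrite /lebesgue2 /completed_measure_extension.
rewrite measurable_mu_extE; last exact: measurable_rectangle.
rewrite /= product_measure1E; [|exact: measurable_itv..].
have len (x y : R) : x <= y ->
    lebesgue_measure (`[x, y]%classic : set R) = (y - x)%:E.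
  rewrite lebesgue_measure_itv /= lte_fin le_eqVlt => /predU1P[->|->].
    by rewrite ltxx subrr.
  by rewrite EFinB.
by rewrite EFinM -len// -len.
Qed.

Lemma compact_rectangle (a b c d : R) : compact (rectangle a b c d).
Proof. by apply: compact_setX; exact: segment_compact. Qed.

(** Open rays generate the Borel sets of the line, and the preimage of one in [D] is the trace of an
    open set of the plane. *)
Lemma continuous_measurable_lebesgue2 (D : set (R * R)) (h : R * R -> R) :
  measurable (D : set plane) -> {within D, continuous h} ->
  measurable_fun (D : set lplane) (h : lplane -> R).
Proof.
move=> mD /continuousP ch; apply:
  (measurability _ (measurable_realfun.RGenOInfty.measurableE R)).
move=> _ [_ [r ->] <-]; apply: lebesgue2_measurable.
have /ch/open_subspaceP[V oV VD] : open (`]r, +oo[%classic : set R) by [].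
rewrite setIC -VD; apply: measurableI => //; exact: open_measurable_plane.
Qed.

Lemma continuous_integrable_lebesgue2 (a b c d : R) (h : R * R -> R) :
  a <= b -> c <= d -> {within rectangle a b c d, continuous h} ->
  (@lebesgue2 R).-integrable (rectangle a b c d) (EFin \o h).
Proof.
move=> ab cd ch; apply: measurable_bounded_integrable.
- exact: (lebesgue2_measurable (measurable_rectangle a b c d)).
- by rewrite [ltLHS](lebesgue2_rectangle ab cd) ltry.
- by apply: continuous_measurable_lebesgue2 => //; exact: measurable_rectangle.
have := compact_bounded (continuous_compact ch (@compact_rectangle a b c d)).
move=> [M [Mr hM]]; exists M; split => // y My x Dx.
by apply: (hM y My); exists x.
Qed.

(** Even at a boundary point, a neighbourhood within the rectangle has positive area. *)
Lemma rectangle_ball (a b c d e : R) (p : R * R) :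
  a < b -> c < d -> rectangle a b c d p -> 0 < e ->
  exists a' b' c' d', [/\ a' < b', c' < d',
    rectangle a' b' c' d' `<=` rectangle a b c d &
    rectangle a' b' c' d' `<=` ball p e].
Proof.
move=> ab cd [/= p1 p2] e0.
have sub (x y z : R) : x < y -> z \in `[x, y] -> exists x' y', [/\ x' < y',
    forall t, t \in `[x', y'] -> t \in `[x, y] &
    forall t, t \in `[x', y'] -> ball z e t].
  move=> xy; rewrite in_itv /= => /andP[xz zy].
  (* Clip [z - e/2, z + e/2] to [x, y]; halving [e] keeps the closed interval inside the open
     ball. *)
  exists (Num.max x (z - e / 2)), (Num.min y (z + e / 2)); split.
  - rewrite lt_min !gt_max xy /=; lra.
  - by move=> t; rewrite !in_itv /= ge_max le_min => /andP[/andP[-> _] /andP[-> _]].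
  - move=> t; rewrite in_itv /= ge_max le_min => /andP[/andP[_ ?] /andP[_ ?]].
    by rewrite -ball_normE /= ltr_distlC; apply/andP; split; lra.
have [a' [b' [ab' Sab Bab]]] := sub _ _ _ ab p1.
have [c' [d' [cd' Scd Bcd]]] := sub _ _ _ cd p2.
exists a', b', c', d'; split => // x [/= x1 x2]; split => /=.
- exact: Sab.
- exact: Scd.
- exact: Bab.
- exact: Bcd.
Qed.

(** By continuity |h| >= |h p| / 2 on some nondegenerate rectangle near [p], which alone contributes
    a positive amount. *)
Lemma Rintegral_norm_gt0_lebesgue2 (a b c d : R) (h : R * R -> R) (p : R * R) :
  a < b -> c < d -> {within rectangle a b c d, continuous h} ->
  rectangle a b c d p -> h p != 0 ->
  0 < \int[@lebesgue2 R]_(x in rectangle a b c d) `|h x|.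
Proof.
move=> ab cd ch Dp hp0.
have ih := continuous_integrable_lebesgue2 (ltW ab) (ltW cd) ch.
have mD := lebesgue2_measurable (measurable_rectangle a b c d).
have hp2 : 0 < `|h p| / 2 by rewrite divr_gt0// normr_gt0.
have [e /= e0 he] : exists2 e, 0 < e & forall x, ball p e x ->
    rectangle a b c d x -> `|h p| / 2 <= `|h x|.
  have /subspace_continuousP/(_ p Dp)/cvgrPdist_lt/(_ _ hp2) := ch.
  rewrite near_withinE => /nbhs_ballP[e e0 he]; exists e => // x xe Dx.
  have /= hpx := he x xe Dx.
  have := lerB_dist (h p) (h x); lra.
have [a' [b' [c' [d' [ab' cd' SD SB]]]]] := rectangle_ball ab cd Dp e0.
have mD' := lebesgue2_measurable (measurable_rectangle a' b' c' d').
have iN := integrable_norm ih.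
apply: (@lt_le_trans _ _
  (\int[@lebesgue2 R]_(x in rectangle a' b' c' d') (`|h p| / 2))).
  rewrite Rintegral_cst// [X in fine X](lebesgue2_rectangle (ltW ab') (ltW cd')).
  rewrite /= mulr_gt0//.
  by rewrite mulr_gt0// subr_gt0.
have iN' : (@lebesgue2 R).-integrable (rectangle a' b' c' d')
    (EFin \o (fun x => `|h x|)).
  exact: integrableS iN.
apply: (@le_trans _ _ (\int[@lebesgue2 R]_(x in rectangle a' b' c' d') `|h x|)).
  apply: le_Rintegral => //.
    by apply: continuous_integrable_lebesgue2; [exact: ltW..|exact: cst_continuous].
  by move=> x Dx; exact: he (SB _ Dx) (SD _ Dx).
rewrite fine_le//; [exact: integrable_fin_num..|].
apply: ge0_subset_integral => //; first exact: measurable_int iN.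
Qed.

End lebesgue2_theory.

(** The feasible set can be empty, for instance when all g_i vanish at a point where f < 0; hence
    [hY]. *)
Theorem theorem2p10 (R : realType) (a b c d : R) (hab : a < b) (hcd : c < d)
    (beta : R) (hbeta : 2 <= beta <= 3)
    (n : nat) (g : 'I_n -> R * R -> R)
    (hgC : forall i, C_beta (rectangle a b c d) beta (g i))
    (hgI : lin_indep_on (rectangle a b c d) g)
    (f : R * R -> R)
    (hfb : exists m : R, forall x, rectangle a b c d x -> m <= f x)
    (hfi : (@lebesgue2 R).-integrable (rectangle a b c d) (fun x => (f x)%:E))
    (hY : Y_below (rectangle a b c d) g f !=set0) :
  exists h_f : R * R -> R, best_approx_below (rectangle a b c d) g f h_f.
Proof.
have [h0 [[c0 h0E] h0f]] := hY.
set D := rectangle a b c d.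
have mD := lebesgue2_measurable (measurable_rectangle a b c d).
have ig i : (@lebesgue2 R).-integrable D (EFin \o g i).
  by apply: continuous_integrable_lebesgue2; [exact: ltW..|exact: (hgC i).1].
have rowE (l : 'I_n -> R) (x : R * R) :
    lincomb g (\row_i l i) x = \sum_(i < n) l i * g i x.
  by apply: eq_bigr => i _; rewrite mxE.
have Npos (l : 'rV[R]_n) :
    l != 0 -> 0 < \int[@lebesgue2 R]_(x in D) `|lincomb g l x|.
  move=> l0.
  (* A combination vanishing on all of [D] would have zero coefficients, by independence. *)
  have [p Dp hp] : exists2 p, D p & lincomb g l p != 0.
    apply: contrapT => noP; move/eqP: l0; apply; apply/rowP => i; rewrite mxE.
    apply: (hgI (l ord0)) => x Dx; apply/eqP/negPn/negP => hx.
    by apply: noP; exists x.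
  apply: Rintegral_norm_gt0_lebesgue2 hab hcd _ Dp hp.
  exact: within_continuous_lincomb (fun i => (hgC i).1).
have [|l1 l1f l1max] := best_lincomb_below mD ig (l0 := \row_i c0 i) hfi Npos.
  by move=> x Dx; rewrite rowE -h0E// h0f.
have Y1 : Y_below D g f (lincomb g l1) by split => //; exists (l1 ord0).
exists (lincomb g l1); split => //; apply/eqP; rewrite eq_le; apply/andP; split.
  by apply: ereal_sup_ubound; exists (lincomb g l1).
apply: ge_ereal_sup => _ [k [[l kE] kf] <-].
(* [k] is a combination only on [D], which suffices for its integral. *)
have klE x : D x -> k x = lincomb g (\row_i l i) x by move=> Dx; rewrite rowE kE.
have -> : (\int[@lebesgue2 R]_(x in D) (k x)%:E =
    \int[@lebesgue2 R]_(x in D) (lincomb g (\row_i l i) x)%:E)%E.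
  by apply: eq_integral => x /set_mem /klE ->.
(* Both integrals are finite, so the comparison reduces to real numbers. *)
have fin l' := integrable_fin_num mD (integrable_lincomb mD ig l').
rewrite -(fineK (fin (\row_i l i))) -(fineK (fin l1)) lee_fin.
by apply: l1max => x Dx; rewrite -klE// kf.
Qed.
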